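(* Let $\alpha\in(0,1)$ be irrational. For $t,t',u\in S_1=[0,1)$ let $\varphi_{t,t'}^u:S_1\to\{-1,1\}$ be given by $\varphi_{t,t'}^u(s)=\varphi_t(s)\cdot\varphi_{t'}(s+u)$, where $\varphi_t=e^{\pi i\mathbf 1_{[0,t)}}$. Then the set $E\subset S_1^2$ of pairs $(t,t')$ such that the cocycles $\varphi_{t,t'}^u$ over the rotation by $\alpha$ are ergodic for all $u\in S_1$ has full product Lebesgue measure $dt\times dt'$.
   Context: $S_1=[0,1)$ with $0=1$ is the circle with addition modulo 1 and Lebesgue measure $ds$. $\mathbb{Z}_2=\{-1,1\}$ is written multiplicatively, with Haar probability measure $d\kappa$. The function $\varphi_t$ equals $-1$ on $[0,t)$ and $1$ elsewhere. A cocycle $\varphi:S_1\to\mathbb{Z}_2$ determines the $\mathbb{Z}_2$-extension $T_\varphi(s,\kappa)=(s+\alpha,\kappa\cdot\varphi(s))$ on $S_1\times\mathbb{Z}_2$; $\varphi$ is called ergodic if the product measure $ds\times d\kappa$ is ergodic under $T_\varphi$. *)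

(* Defs.v *)
From HB Require Import structures.
From mathcomp Require Import all_boot all_order all_algebra.
From mathcomp Require Import all_classical all_reals all_analysis.

Set Implicit Arguments.
Unset Strict Implicit.
Unset Printing Implicit Defensive.

Import Order.TTheory GRing.Theory Num.Theory.
Import numFieldNormedType.Exports.

Local Open Scope classical_set_scope.
Local Open Scope ring_scope.

(* The phase space is a measurable subset D of an ambient measurable type,
   with the trace of the ambient sigma-algebra and of mu. *)
Definition measure_preserving_on (d : measure_display) (X : measurableType d)
    (R : realType) (mu : set X -> \bar R) (D : set X) (T : X -> X) : Prop :=
  [/\ set_fun D D T, measurable_fun D T &
      forall A : set X, measurable A -> A `<=` D ->
        mu (D `&` T @^-1` A) = mu A].

Definition ergodic_on (d : measure_display) (X : measurableType d)
    (R : realType) (mu : set X -> \bar R) (D : set X) (T : X -> X) : Prop :=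
  measure_preserving_on mu D T /\
  forall A : set X, measurable A -> A `<=` D -> D `&` T @^-1` A = A ->
    mu A = 0%E \/ mu (D `\` A) = 0%E.

Section circle_extensions.
Variable R : realType.

(* The circle group is the set of representatives [0, 1[ in R, and Z_2 is the
   set {-1, 1} in R; maps on them are given on all of R, and their values
   outside these sets play no role. *)
Definition circle : set R := [set` `[0, 1[%R].

Definition circle_add (s t : R) : R := (s + t) - (Num.floor (s + t))%:~R.

Definition Z2 : set R := [set -1; 1].

Definition haar_Z2 : set R -> \bar R :=
  mscale (2^-1)%:nng (measure_add (\d_(-1 : R)) (\d_(1 : R))).

HB.instance Definition _ := Measure.on haar_Z2.

Lemma haar_Z2_setT : haar_Z2 [set: R] = 1%:E.
Proof.
transitivity ((2^-1)%:E * (\d_(-1 : R)%R setT + \d_(1 : R)%R setT) : \bar R)%E.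
  by congr (_ * _)%E; exact: measure_addE.
by rewrite !diracT -EFinD -EFinM mulVf.
Qed.

HB.instance Definition _ :=
  Measure_isProbability.Build _ _ _ haar_Z2 haar_Z2_setT.

Definition Z2_extension (alpha : R) (phi : R -> R) (x : R * R) : R * R :=
  (circle_add x.1 alpha, x.2 * phi x.1).

Definition ergodic_cocycle (alpha : R) (phi : R -> R) : Prop :=
  ergodic_on (lebesgue_measure \x haar_Z2)%E
    (circle `*` Z2) (Z2_extension alpha phi).

Definition phi_step (t s : R) : R := if s \in `[0, t[ then -1 else 1.

Definition phi_pair (t t' u s : R) : R :=
  phi_step t s * phi_step t' (circle_add s u).

Definition ergodic_pairs (alpha : R) : set (R * R) :=
  [set p | [/\ circle p.1, circle p.2 &
     forall u : R, circle u -> ergodic_cocycle alpha (phi_pair p.1 p.2 u)]].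

End circle_extensions.

(* Main.v *)
Require Import Defs.
From HB Require Import structures.
From mathcomp Require Import all_boot all_order all_algebra.
From mathcomp Require Import all_classical all_reals all_analysis.
From mathcomp Require Import measurable_realfun zify ring lra.

Set Implicit Arguments.
Unset Strict Implicit.
Unset Printing Implicit Defensive.

Import Order.TTheory GRing.Theory Num.Theory.
Import numFieldNormedType.Exports.

Local Open Scope classical_set_scope.
Local Open Scope ring_scope.

(* Write a Z_2-valued cocycle additively, as a boolean function. If the extension by
   [phi_t(s) phi_t'(s + u)] is not ergodic, this cocycle is a coboundary, so its Birkhoff sums
   over rigidity times [q_n] (where [q_n alpha] tends to 0 mod 1) tend to 0 in measure: the sums
   of [phi_t] over [q_n] steps agree asymptotically with a translate by [u] of those of
   [phi_t']. A translation invariant quantity forgets [u]; take the measure [A_n(t)] of the set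
   where the sum of [phi_t] changes between [s] and [s + x_n]. Since
   [phi_t(s) phi_t(s + x) = psi_x(s) psi_x(s - t)], where [psi_x = -1] exactly on [1 - x, 1),
   [A_n(t)] is the measure by which the Birkhoff sum [Psi_n] of [psi_(x_n)] differs from its
   shift by [t]. So it suffices that [A_n(t) - A_n(t')] tends to 0 for almost no pair
   [(t, t')]. For fixed [t'] the set of such [t] is invariant under the rotation, hence null or
   conull. Choose [q_n] with [q_n alpha] closer to an integer than [r alpha] for [0 < r < q_n],
   and [x_n = 1 / (8 q_n)]: then the orbit segment of length [q_n] is [1 / (2 q_n)]-separated,
   and [A_n] is at most 1/8 and at least 1/4 on sets of measure bounded below, which rules out
   the conull case. *)

(** * Periodic boolean functions on the line and their measure on the circle *)

Section circle_events.
Variable R : realType.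
Implicit Types (f g h : R -> bool) (s t u x y : R).

Local Notation mu := (@lebesgue_measure R).

Lemma lebesgue_measure_shift u (A : set R) : measurable A ->
  mu ((fun s => s + u) @^-1` A) = mu A.
Proof.
move=> mA; have mf : measurable_fun setT (fun s : R => s + u).
  exact: measurable_funD.
apply/esym; rewrite -[RHS]/(pushforward mu (fun s => s + u : measurableTypeR R) A).
apply: lebesgue_measure_unique => //= X [[a b] _ <-] /=; rewrite /pushforward.
have -> : (fun s => s + u) @^-1` `]a, b] = `]a - u, b - u]%classic.
  by apply/seteqP; split => s /=; rewrite !in_itv /= => /andP[? ?];
    apply/andP; split; lra.
by rewrite !lebesgue_measure_itv /= !lte_fin ltrD2r -!EFinB opprB addrA subrK.
Qed.

(* Subsets of the circle are encoded as 1-periodic boolean functions on [R]; [cm] is their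
   measure, and [addb] plays the role of the product of Z_2-valued cocycles. *)
Definition event f := measurable_fun setT f /\ forall s, f (s + 1) = f s.

Definition cm f : R := fine (mu ([set s | f s] `&` `[0, 1[)).

Lemma measurable_event f : measurable_fun setT f -> measurable [set s | f s].
Proof.
move=> mf; have := mf measurableT [set true] I.
by rewrite setTI.
Qed.

Lemma measurable_event_itv f (i : interval R) : measurable_fun setT f ->
  measurable ([set s | f s] `&` [set` i]).
Proof. move=> mf; apply: measurableI; first exact (measurable_event mf).
exact: measurable_itv. Qed.

Lemma cmE f : measurable_fun setT f ->
  mu ([set s | f s] `&` `[0, 1[) = (cm f)%:E.
Proof.
move=> mf; rewrite /cm fineK// ge0_fin_numE//.
apply: (@le_lt_trans _ _ (mu `[0, 1[)); last first.
  by rewrite lebesgue_measure_itv /= lte_fin ltr01 oppr0 adde0 ltry.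
apply: le_measure; rewrite ?inE//; exact: measurable_event_itv.
Qed.

Lemma measurable_xor f g : measurable_fun setT f -> measurable_fun setT g ->
  measurable_fun setT (fun s => f s (+) g s).
Proof.
move=> mf mg.
rewrite (_ : (fun s => _) = (fun s => (f s && ~~ g s) || (~~ f s && g s))).
  by apply: measurable_or; apply: measurable_and => //; exact: measurable_neg.
by apply/funext => s; case: (f s); case: (g s).
Qed.

Lemma measurable_shift f u : measurable_fun setT f ->
  measurable_fun setT (fun s => f (s + u)).
Proof. by move=> mf; apply: (measurableT_comp mf); exact: measurable_funD. Qed.

Lemma event_xor f g : event f -> event g -> event (fun s => f s (+) g s).
Proof.
move=> [mf pf] [mg pg]; split; first exact: measurable_xor.
by move=> s; rewrite pf pg.
Qed.

Lemma event_and f g : event f -> event g -> event (fun s => f s && g s).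
Proof.
move=> [mf pf] [mg pg]; split; first exact: measurable_and.
by move=> s; rewrite pf pg.
Qed.

Lemma event_or f g : event f -> event g -> event (fun s => f s || g s).
Proof.
move=> [mf pf] [mg pg]; split; first exact: measurable_or.
by move=> s; rewrite pf pg.
Qed.

Lemma event_neg f : event f -> event (fun s => ~~ f s).
Proof.
move=> [mf pf]; split; first exact: measurable_neg.
by move=> s; rewrite pf.
Qed.

Lemma event_shift f u : event f -> event (fun s => f (s + u)).
Proof.
move=> [mf pf]; split; first exact: measurable_shift.
by move=> s; rewrite addrAC pf.
Qed.

Lemma event_periodz f (n : int) s : event f -> f (s + n%:~R) = f s.
Proof.
move=> [_ pf]; have H (k : nat) y : f (y + k%:R) = f y.
  elim: k => [|k IH]; first by rewrite addr0.
  by rewrite -natr1 addrA pf.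
case: n => n; first by rewrite -[in RHS](H n).
by rewrite NegzE mulrNz -[LHS](H n.+1) subrK.
Qed.

Lemma cm_ge0 f : 0 <= cm f.
Proof. exact: fine_ge0. Qed.

Lemma cm_cst (b : bool) : cm (fun=> b) = b%:R.
Proof.
rewrite /cm; case: b.
  rewrite (_ : [set _ | _] = setT); last by apply/seteqP; split.
  by rewrite setTI lebesgue_measure_itv /= lte_fin ltr01 oppr0 adde0.
rewrite (_ : [set _ | _] = set0); last by apply/seteqP; split.
by rewrite set0I measure0.
Qed.

Lemma cm_le f g : measurable_fun setT f -> measurable_fun setT g ->
  (forall s, 0 <= s < 1 -> f s -> g s) -> cm f <= cm g.
Proof.
move=> mf mg fg; rewrite -lee_fin -!cmE//; apply: le_measure; rewrite ?inE.
- exact: measurable_event_itv.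
- exact: measurable_event_itv.
- by move=> s [/= fs]; rewrite in_itv /= => s01; split => //; exact: fg.
Qed.

Lemma cm_eq f g : (forall s, 0 <= s < 1 -> f s = g s) -> cm f = cm g.
Proof.
move=> fg; rewrite /cm; congr (fine (mu _)); apply/seteqP.
by split => s [/= fs]; rewrite in_itv /= => s01; split => //=;
  rewrite -?fg // fg.
Qed.

Lemma cm_disjoint f g : measurable_fun setT f -> measurable_fun setT g ->
  (forall s, f s -> ~~ g s) -> cm (fun s => f s || g s) = cm f + cm g.
Proof.
move=> mf mg fg; apply: EFin_inj; rewrite EFinD -!cmE//; last first.
  exact: measurable_or.
rewrite -measureU//; [|exact: measurable_event_itv|exact: measurable_event_itv|].
  rewrite -setIUl; congr (mu (_ `&` _)); apply/seteqP.
  split => s /=; first by move/orP.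
  by move/orP.
by apply/seteqP; split => s //= [[fs _] [gs _]]; have := fg _ fs; rewrite gs.
Qed.

Lemma cm_neg f : measurable_fun setT f -> cm (fun s => ~~ f s) = 1 - cm f.
Proof.
move=> mf; apply/eqP; rewrite eq_sym subr_eq addrC -cm_disjoint//; last 2 first.
- exact: measurable_neg.
- by move=> s ->.
by rewrite (@cm_eq _ (fun=> true)) ?cm_cst// => s _; case: (f s).
Qed.

Lemma cm_le1 f : measurable_fun setT f -> cm f <= 1.
Proof. by move=> mf; have := cm_ge0 (fun s => ~~ f s); rewrite cm_neg// subr_ge0. Qed.

Lemma cm_split f g : measurable_fun setT f -> measurable_fun setT g ->
  cm f = cm (fun s => f s && g s) + cm (fun s => f s && ~~ g s).
Proof.
move=> mf mg; rewrite -cm_disjoint.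
- by apply: cm_eq => s _; case: (f s); case: (g s).
- exact: measurable_and.
- by apply: measurable_and => //; exact: measurable_neg.
- by move=> s; case: (f s); case: (g s).
Qed.

Lemma cm_or f g : measurable_fun setT f -> measurable_fun setT g ->
  cm (fun s => f s || g s) <= cm f + cm g.
Proof.
move=> mf mg; rewrite (@cm_split (fun s => f s || g s) f)//; last first.
  exact: measurable_or.
apply: lerD; apply: cm_le => //.
- by apply: measurable_and => //; exact: measurable_or.
- by move=> s _; case: (f s); case: (g s).
- by apply: measurable_and; [exact: measurable_or|exact: measurable_neg].
- by move=> s _; case: (f s); case: (g s).
Qed.

Lemma cm_xor f g h : measurable_fun setT f -> measurable_fun setT g ->
  measurable_fun setT h ->
  cm (fun s => f s (+) h s) <=
  cm (fun s => f s (+) g s) + cm (fun s => g s (+) h s).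
Proof.
move=> mf mg mh; apply: (le_trans _ (cm_or _ _)); try exact: measurable_xor.
apply: cm_le; [exact: measurable_xor|apply: measurable_or; exact: measurable_xor|].
by move=> s _; case: (f s); case: (g s); case: (h s).
Qed.

(** By periodicity [u] may be replaced by its fractional part [v]. Translation carries [0, 1[ onto
    [v, 1 + v[; the piece beyond 1, moved back by 1, fills the missing [0, v[. *)
Lemma cm_shift f u : event f -> cm (fun s => f (s + u)) = cm f.
Proof.
move=> ef; pose v := u - (Num.floor u)%:~R.
have uv s : f (s + u) = f (s + v).
  by rewrite -(event_periodz (Num.floor u) (s + v) ef) /v addrA subrK.
rewrite (cm_eq (g := fun s => f (s + v))) => [|s _]; last exact: uv.
have /andP[v0 v1] : 0 <= v < 1.
  by have := floor_itv u; rewrite /v intrD mulr1z => /andP[? ?]; apply/andP; split; lra.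
move: v v0 v1 {uv} => v v0 v1; have [mf pf] := ef.
apply: EFin_inj; rewrite -!cmE//; last exact: measurable_shift.
have mlo : measurable ([set s | f s] `&` `[v, 1[) by exact: measurable_event_itv.
have mhi : measurable ([set s | f s] `&` `[0, v[) by exact: measurable_event_itv.
have mhi1 : measurable ([set s | f s] `&` `[1, 1 + v[) by exact: measurable_event_itv.
have mco : measurable ([set s | f s] `&` `[v, 1 + v[) by exact: measurable_event_itv.
rewrite (_ : _ `&` _ = (fun s => s + v) @^-1` ([set s | f s] `&` `[v, 1 + v[)).
  rewrite lebesgue_measure_shift//.
  rewrite (_ : _ `&` _ = ([set s | f s] `&` `[v, 1[) `|` ([set s | f s] `&` `[1, 1 + v[)).
    rewrite measureU//; last first.
      by apply/seteqP; split => s //= [[_ +] [_]]; rewrite !in_itv /=; lra.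
    rewrite -[X in (_ + X)%E](@lebesgue_measure_shift 1)//.
    rewrite (_ : _ @^-1` _ = [set s | f s] `&` `[0, v[); last first.
      by apply/seteqP; split => s /= [fs]; rewrite !in_itv /= => sv;
        (split; [by rewrite ?pf// -pf | lra]).
    rewrite -measureU//; last first.
      by apply/seteqP; split => s //= [[_ +] [_]]; rewrite !in_itv /=; lra.
    rewrite -setIUr; congr (mu (_ `&` _)); apply/seteqP; split => s /=; rewrite !in_itv /=.
      by move=> [] /andP[? ?]; apply/andP; split; lra.
    by move=> /andP[? ?]; have [?|?] := ltP s v; [right|left]; apply/andP; split; lra.
  rewrite -setIUr; congr (_ `&` _); apply/seteqP; split => s /=; rewrite !in_itv /=.
    by move=> /andP[? ?]; have [?|?] := ltP s 1; [left|right]; apply/andP; split; lra.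
  by move=> [] /andP[? ?]; apply/andP; split; lra.
by apply/seteqP; split => s /= [fs]; rewrite !in_itv /= => /andP[? ?]; split => //;
  apply/andP; split; lra.
Qed.

(* Compact inner and open outer approximations of [f] on [0, 1[: a small enough shift
   maps the compact set into the open one. *)
Lemma cm_shift_continuous f (e : R) : event f -> 0 < e ->
  exists2 d : R, 0 < d &
    forall u, `|u| < d -> cm (fun s => f s (+) f (s + u)) < e.
Proof.
move=> ef e0; have [mf pf] := ef; pose A := [set s | f s] `&` `[0, 1[.
have mA : measurable A by exact: measurable_event_itv.
have Aoo : (mu A < +oo)%E by rewrite cmE// ltry.
(* Two approximation errors enter each of the two one-sided differences [f && ~~ f (. + u)] and
   [f (. + u) && ~~ f]. *)
have e4 : 0 < e / 4 by lra.
have [K [cK KA AK]] := lebesgue_regularity_inner mA Aoo e4.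
have [U [oU AU UA]] := lebesgue_regularity_outer mA Aoo e4.
have mK : measurable K by exact: compact_measurable.
have mU : measurable U by exact: open_measurable.
have : \forall u \near nbhs (0 : R), K `<=` (fun s => U (s + u)).
  apply: ((compact_near_coveringP K).1 cK R (nbhs (0 : R))
    (fun u s => U (s + u)) (nbhs_filter (0 : R))) => x /KA/AU Ux.
  have /nbhs_ballP[d /= d0 dU] : nbhs x U by exact: open_nbhs_nbhs.
  have d2 : 0 < d / 2 by rewrite divr_gt0.
  exists (ball x (d / 2), ball 0 (d / 2)); first by split; exact: nbhsx_ballx.
  move=> [y u] [/=]; rewrite /ball /= => xy u0; apply: dU; rewrite /ball /=.
  rewrite (_ : x - (y + u) = (x - y) + (0 - u)); last by ring.
  by rewrite (le_lt_trans (ler_normD _ _))//; lra.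
move=> /nbhs_ballP[d /= d0 KU]; exists d => // u ud.
have {}KU s : K s -> U (s + u).
  by apply: KU; rewrite /ball /= sub0r normrN.
have mfu : measurable_fun setT (fun s => f (s + u)) by exact: measurable_shift.
have half : cm (fun s => f s && ~~ f (s + u)) < e / 2.
  rewrite -lte_fin -cmE; last by apply: measurable_and => //; exact: measurable_neg.
  have mUA : measurable ((fun s => s + u) @^-1` (U `\` A)).
    rewrite -[X in measurable X]setTI; apply: measurable_funD => //.
    exact: measurableD.
  apply: (@le_lt_trans _ _ (mu (A `\` K) + mu ((fun s => (s + u)%R) @^-1` (U `\` A)))%E).
    apply: le_trans (measureU2 _ _ _) => //.
    - apply: le_measure; rewrite ?inE.
      + by apply: measurable_event_itv; apply: measurable_and => //; exact: measurable_neg.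
      + by apply: measurableU => //; exact: measurableD.
      + move=> s [/= /andP[fs fsu] s01].
        have [Ks|nKs] := pselect (K s); [right|by left].
        by split; [exact: KU|case=> /=; rewrite (negbTE fsu)].
    - exact: measurableD.
  rewrite lebesgue_measure_shift//; last exact: measurableD.
  by rewrite (_ : e / 2 = e / 4 + e / 4) ?EFinD ?lteD//; lra.
(* Since [f] and its shift have the same measure, the two one-sided differences do as well, so that
   the bound for one serves for both. *)
have sym : cm (fun s => f s && ~~ f (s + u)) = cm (fun s => f (s + u) && ~~ f s).
  have := cm_shift u ef; rewrite (cm_split mf mfu) (cm_split mfu mf).
  rewrite (@cm_eq (fun s => f (s + u) && f s) (fun s => f s && f (s + u))).
    lra.
  by move=> s _; rewrite andbC.
rewrite (@cm_eq _ (fun s => (f s && ~~ f (s + u)) || (f (s + u) && ~~ f s))).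
  rewrite (le_lt_trans (cm_or _ _))// -?sym; last lra.
  - by apply: measurable_and => //; exact: measurable_neg.
  - by apply: measurable_and => //; exact: measurable_neg.
by move=> s _; case: (f s); case: (f (s + u)).
Qed.

End circle_events.

(** * Dirichlet approximation and ergodicity of the irrational rotation *)

Section rotation.
Variable R : realType.
Implicit Types (f g h : R -> bool) (s t u x y : R).

Local Notation mu := (@lebesgue_measure R).

(** Pigeonhole: among the [N + 1] fractional parts of [j alpha], [j <= N], two fall into the same
    one of [N] boxes of length [1 / N < e]; [q] is the difference of their indices. *)
Lemma dirichlet (alpha e : R) : 0 < e ->
  exists q : nat, exists2 p : int, (0 < q)%N & `|q%:R * alpha - p%:~R| < e.
Proof.
move=> e0; have [M Me] : exists M : nat, M.+1%:R^-1 < e.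
  exists (Num.trunc e^-1); rewrite -[ltRHS]invrK ltf_pV2 ?posrE ?invr_gt0//.
  exact: truncnS_gt.
set N := M.+1 in Me; have N0 : 0 < N%:R :> R by rewrite ltr0n.
pose fr (j : nat) := j%:R * alpha - (Num.floor (j%:R * alpha))%:~R.
have fr01 j : 0 <= fr j < 1.
  have := floor_itv (j%:R * alpha); rewrite /fr intrD mulr1z => /andP[? ?].
  by apply/andP; split; lra.
pose F (j : 'I_N.+1) : 'I_N := inord (Num.trunc (N%:R * fr j)).
have /injectivePn[j [k jk Fjk]] : ~~ injectiveb F.
  by apply/negP => /injectiveP /leq_card; rewrite !card_ord ltnn.
have trN (i : 'I_N.+1) : (Num.trunc (N%:R * fr i) < N)%N.
  have /andP[i0 i1] := fr01 i.
  rewrite truncn_lt_nat; last by apply: mulr_ge0 => //; exact: ltW.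
  by rewrite gtr_pMr.
have {}Fjk : Num.trunc (N%:R * fr j) = Num.trunc (N%:R * fr k).
  by have := congr1 val Fjk; rewrite [LHS](inordK (trN j)) [RHS](inordK (trN k)).
have close (i l : 'I_N.+1) : Num.trunc (N%:R * fr i) = Num.trunc (N%:R * fr l) ->
    fr l - fr i < N%:R^-1.
  move=> il; rewrite -(ltr_pM2l N0) divff ?gt_eqF// mulrBr.
  have /andP[i0 i1] := fr01 i; have /andP[l0 l1] := fr01 l.
  have /andP[a _] := truncn_itv (mulr_ge0 (ltW N0) i0).
  have b := truncnS_gt (N%:R * fr l).
  by move: a b; rewrite il -natr1; lra.
have jk1 : `|fr k - fr j| < N%:R^-1.
  by rewrite ltr_norml; have := close j k Fjk; have := close k j (esym Fjk);
    move=> ? ?; apply/andP; split; lra.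
wlog jltk : j k jk Fjk jk1 / (j < k)%N.
  move=> H; have [//|kj|/val_inj jk'] := ltngtP j k.
  - exact: (H j k).
  - apply: (H k j) kj; [by rewrite eq_sym|exact: esym|by rewrite distrC].
  - by rewrite jk' eqxx in jk.
exists (k - j)%N; exists (Num.floor (k%:R * alpha) - Num.floor (j%:R * alpha)).
  by rewrite subn_gt0.
rewrite (_ : _ - _ = fr k - fr j) ?(lt_trans jk1)//.
by rewrite natrB 1?ltnW// intrB /fr; ring.
Qed.

Lemma irrational_neq (alpha : R) (q : nat) (p : int) :
  irrational alpha -> (0 < q)%N -> q%:R * alpha - p%:~R != 0.
Proof.
move=> irr q0; apply/eqP => /subr0_eq qp; apply: irr.
by apply/rationalP; exists p, q; rewrite -qp [X in X / _]mulrC mulfK// pnatr_eq0 -lt0n.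
Qed.

Lemma shift_mulrn f (a : R) (n : nat) s :
  (forall s, f (s + a) = f s) -> f (s + n%:R * a) = f s.
Proof.
move=> fa; elim: n s => [|n IH] s; first by rewrite mul0r addr0.
by rewrite -natr1 mulrDl mul1r addrA fa.
Qed.

Lemma shift_mulrz f (a : R) (n : int) s :
  (forall s, f (s + a) = f s) -> f (s + n%:~R * a) = f s.
Proof.
move=> fa; case: n => n; first exact: shift_mulrn.
rewrite NegzE mulrNz mulNr -[LHS](@shift_mulrn f a n.+1)//.
by rewrite subrK.
Qed.

(** [h] is invariant under an arbitrarily small nonzero [a = q alpha - p], hence under its
    multiples, and [u] is within [|a|] of one of them. Continuity of the shift, applied with the
    supposedly positive measure as its own tolerance, gives a contradiction. *)
Lemma shift_invariant (alpha : R) h u : irrational alpha -> event h ->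
  (forall s, h (s + alpha) = h s) -> cm (fun s => h s (+) h (s + u)) = 0.
Proof.
move=> irr eh ha; apply/eqP; rewrite eq_le cm_ge0 andbT leNgt; apply/negP => c0.
have [d d0 hd] := cm_shift_continuous eh c0.
have [q [p q0 qp]] := dirichlet alpha d0.
set a := q%:R * alpha - p%:~R in qp.
have a0 : a != 0 by exact: irrational_neq.
have haa s : h (s + a) = h s.
  by rewrite /a addrA -intrN event_periodz// shift_mulrn.
pose j := Num.floor (u / a).
have uj : `|u - j%:~R * a| < d.
  rewrite (lt_trans _ qp)// -[X in `|X - _|](divfK a0) -mulrBl normrM.
  rewrite gtr_pMl ?normr_gt0// ltr_norml.
  have := floor_itv (u / a); rewrite intrD mulr1z -/j => /andP[? ?].
  by apply/andP; split; lra.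
have := hd _ uj; rewrite (@cm_eq _ _ (fun s => h s (+) h (s + u))) ?ltxx//.
by move=> s _; rewrite addrA -mulNr -intrN shift_mulrz.
Qed.

(* A rotation-invariant event is almost invariant under all shifts, so Fubini on
   [{(s, u) | h s, ~~ h (s + u)}] gives [cm h * (1 - cm h) = 0]. *)
Lemma rotation_ergodic (alpha : R) h : irrational alpha -> event h ->
  (forall s, h (s + alpha) = h s) -> cm h = 0 \/ cm h = 1.
Proof.
move=> irr eh ha; have [mh ph] := eh.
have mI : measurable (`[0, 1[%classic : set R) by exact: measurable_itv.
pose b (z : R * R) := h z.1 && ~~ h (z.1 + z.2).
pose W := [set z | b z] `&` (`[0, 1[ `*` `[0, 1[).
have mb : measurable_fun setT b.
  apply: measurable_and; first exact: measurableT_comp.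
  apply: measurable_neg; apply: measurableT_comp => //.
  by apply: measurable_funD; [exact: measurable_fst|exact: measurable_snd].
have mW : measurable W.
  apply: measurableI; last exact: measurableX.
  by have := mb measurableT [set true] I; rewrite setTI.
have Wx x : mu (xsection W x) =
    ((1 - cm h)%:E * (\1_([set s | h s] `&` `[0, 1[) x)%:E)%E.
  rewrite indicE; have [|xn] := boolP (x \in [set s | h s] `&` `[0, 1[).
    rewrite inE => -[/= hx x01]; rewrite mule1 -cm_neg// -(cm_shift x); last exact: event_neg.
    rewrite -cmE; last by apply: measurable_neg; exact: measurable_shift.
    congr (mu _); apply/seteqP; split => u; rewrite /xsection /= inE /W /b /=.
      by move=> [/andP[_ hu] [_ u01]]; rewrite addrC.
    by move=> [hu u01]; rewrite hx addrC.
  rewrite mule0 (_ : xsection _ _ = set0) ?measure0//; apply/seteqP; split => // u.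
  rewrite /xsection /= inE /W /b /= => -[/andP[hx _] [x01 _]].
  by move: xn; rewrite notin_setE; apply.
have Wy y : mu (ysection W y) = 0%E.
  apply/eqP; rewrite eq_le measure_ge0 andbT.
  rewrite (_ : 0%E = (cm (fun s => h s (+) h (s + y)))%:E); last first.
    by rewrite (shift_invariant _ irr).
  rewrite -cmE; last by apply: measurable_xor => //; exact: measurable_shift.
  apply: le_measure; rewrite ?inE.
  - exact: measurable_ysection.
  - by apply: measurable_event_itv; apply: measurable_xor => //; exact: measurable_shift.
  - by move=> s; rewrite /ysection /= inE /W /b /= => -[/andP[-> /negbTE ->] []].
have E1 : (\int[mu]_x mu (xsection W x) = ((1 - cm h) * cm h)%:E)%E.
  under eq_integral do rewrite Wx.
  rewrite ge0_integralZl//; last 2 first.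
  - by apply/measurable_EFinP; apply: measurable_indic; exact: measurable_event_itv.
  - by rewrite lee_fin subr_ge0 cm_le1.
  rewrite integral_indic//; last exact: measurable_event_itv.
  by rewrite setIT EFinM; congr (_ * _)%E; exact: cmE.
have E2 : (\int[mu]_y mu (ysection W y) = 0)%E by exact: integral0_eq.
have := indic_fubini_tonelli mu mu mW.
rewrite indic_fubini_tonelli_FE// indic_fubini_tonelli_GE// [LHS]E1 [RHS]E2.
by move=> -[/eqP]; rewrite mulf_eq0 => /orP[|] /eqP; lra.
Qed.

End rotation.

(** * Arcs, Birkhoff sums mod 2, and the distance from an event to its translates *)

Section shift_distance.
Variable R : realType.
Implicit Types (f g h : R -> bool) (s t u x y alpha : R).

Definition fpart s : R := s - (Num.floor s)%:~R.

Lemma fpart_itv s : 0 <= fpart s < 1.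
Proof.
have := floor_itv s; rewrite intrD mulr1z /fpart => /andP[? ?].
by apply/andP; split; lra.
Qed.

Lemma fpart_id s : 0 <= s < 1 -> fpart s = s.
Proof. by move=> s01; rewrite /fpart (@floor_def _ _ 0) ?subr0. Qed.

Lemma fpart_addz s (n : int) : fpart (s + n%:~R) = fpart s.
Proof.
by rewrite /fpart floorDrz ?intr_int// intrKfloor intrD opprD addrACA subrr addr0.
Qed.

Lemma measurable_fpart : measurable_fun setT fpart.
Proof.
apply: measurable_funB => //; apply: nondecreasing_measurable => //.
by move=> x y xy; rewrite ler_int le_floor.
Qed.

(** The boolean, periodic form of [phi_t]; [final_arc x] below plays the same role for the function
    psi_x of the overview. *)
Definition initial_arc t s := fpart s < t.

Definition final_arc x s := 1 - x <= fpart s.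

Lemma event_initial_arc t : event (initial_arc t).
Proof.
split; first by apply: measurable_fun_ltr => //; exact: measurable_fpart.
by move=> s; rewrite /initial_arc (fpart_addz s 1).
Qed.

Lemma event_final_arc x : event (final_arc x).
Proof.
split; first by apply: measurable_fun_ler => //; exact: measurable_fpart.
by move=> s; rewrite /final_arc (fpart_addz s 1).
Qed.

Lemma cm_initial_arc t : 0 <= t <= 1 -> cm (initial_arc t) = t.
Proof.
move=> /andP[t0 t1]; rewrite /cm (_ : _ `&` _ = `[0, t[%classic); last first.
  apply/seteqP; split => s /=; rewrite !in_itv /= /initial_arc.
    by move=> [+ s01]; rewrite fpart_id// (andP s01).1.
  move=> /andP[s0 st]; have s01 : 0 <= s < 1 by rewrite s0 (lt_le_trans st).
  by rewrite fpart_id.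
rewrite lebesgue_measure_itv /= lte_fin; case: ltP => [_|?] /=.
  by rewrite subr0.
lra.
Qed.

Lemma cm_final_arc x : 0 <= x <= 1 -> cm (final_arc x) = x.
Proof.
move=> x01; have -> : final_arc x = (fun s => ~~ initial_arc (1 - x) s).
  by apply/funext => s; rewrite /initial_arc -leNgt.
by rewrite cm_neg ?cm_initial_arc; [|lra|exact: (event_initial_arc _).1]; lra.
Qed.

(** Adding 1 flips this parity, so it does not live on the circle; on the line it is a common
    primitive, of which initial and final arcs are differences. *)
Definition floor_odd s := odd `|Num.floor s|.

Lemma odd_absz_succ (n : int) : odd `|n + 1| = ~~ odd `|n|.
Proof. by case: n => [n|n]; rewrite ?NegzE /=; lia. Qed.

Lemma initial_arcE t s : 0 <= t < 1 -> initial_arc t s = floor_odd s (+) floor_odd (s - t).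
Proof.
move=> /andP[t0 t1]; have /andP[s0 s1] := fpart_itv s.
rewrite /initial_arc /floor_odd; case: ltP => st.
  have -> : Num.floor (s - t) = Num.floor s - 1.
    by apply: floor_def; move: s0 s1 st; rewrite /fpart !intrD intrN mulr1z; lra.
  by rewrite -[in X in X (+) _](subrK 1 (Num.floor s)) odd_absz_succ; case: odd.
have -> : Num.floor (s - t) = Num.floor s.
  by apply: floor_def; move: s0 s1 st; rewrite /fpart !intrD mulr1z; lra.
by rewrite addbb.
Qed.

Lemma final_arcE x s : 0 <= x < 1 -> final_arc x s = floor_odd s (+) floor_odd (s + x).
Proof.
move=> /andP[x0 x1]; have /andP[s0 s1] := fpart_itv s.
rewrite /final_arc /floor_odd; case: leP => sx.
  have -> : Num.floor (s + x) = Num.floor s + 1.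
    by apply: floor_def; move: s0 s1 sx; rewrite /fpart !intrD mulr1z; lra.
  by rewrite odd_absz_succ; case: odd.
have -> : Num.floor (s + x) = Num.floor s.
  by apply: floor_def; move: s0 s1 sx; rewrite /fpart !intrD mulr1z; lra.
by rewrite addbb.
Qed.

(** Both sides are the second difference of [floor_odd] with steps [x] and [- t], taken in either
    order. *)
Lemma initial_arc_final_arc t x s : 0 <= t < 1 -> 0 <= x < 1 ->
  initial_arc t s (+) initial_arc t (s + x) = final_arc x s (+) final_arc x (s - t).
Proof.
move=> t01 x01; rewrite !initial_arcE// !final_arcE// (_ : s + x - t = s - t + x); last by ring.
by rewrite addbACA.
Qed.

Definition birk alpha f (q : nat) s := \big[addb/false]_(j < q) f (s + j%:R * alpha).

Lemma birk0 alpha f s : birk alpha f 0 s = false.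
Proof. by rewrite /birk big_ord0. Qed.

Lemma birkS alpha f q s :
  birk alpha f q.+1 s = birk alpha f q s (+) f (s + q%:R * alpha).
Proof. by rewrite /birk big_ord_recr. Qed.

Lemma birk_xor alpha f g q s :
  birk alpha (fun s => f s (+) g s) q s = birk alpha f q s (+) birk alpha g q s.
Proof. by rewrite /birk big_split. Qed.

Lemma birk_shift alpha f q s u :
  birk alpha (fun s => f (s + u)) q s = birk alpha f q (s + u).
Proof. by apply: eq_bigr => j _; rewrite addrAC. Qed.

Lemma event_birk alpha f q : event f -> event (birk alpha f q).
Proof.
move=> ef; elim: q => [|q IH].
  rewrite (_ : birk _ _ _ = fun=> false); last by apply/funext => s; rewrite birk0.
  by split.
rewrite (_ : birk _ _ _ = fun s => birk alpha f q s (+) f (s + q%:R * alpha)).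
  by apply: event_xor => //; exact: event_shift.
by apply/funext => s; rewrite birkS.
Qed.

Lemma cm_birk alpha f q : event f -> cm (birk alpha f q) <= q%:R * cm f.
Proof.
move=> ef; elim: q => [|q IH].
  by rewrite (cm_eq (g := fun=> false)) ?cm_cst ?mul0r// => s _; rewrite birk0.
rewrite -natr1 mulrDl mul1r -[X in _ + X](cm_shift (q%:R * alpha) ef).
apply: (le_trans _ (lerD IH (lexx _))).
have e1 := event_birk alpha q ef; have e2 := event_shift (q%:R * alpha) ef.
apply: (le_trans _ (cm_or e1.1 e2.1)).
apply: cm_le; [exact: (event_birk _ _ ef).1|exact: (event_or e1 e2).1|].
by move=> s _; rewrite birkS; case: birk; case: (f _).
Qed.

Lemma birk_exists alpha f q s : birk alpha f q s ->
  exists2 j : nat, (j < q)%N & f (s + j%:R * alpha).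
Proof.
elim: q => [|q IH]; first by rewrite birk0.
rewrite birkS; have [fq _|_] := boolP (f (s + q%:R * alpha)); first by exists q.
by rewrite addbF => /IH[j jq fj]; exists j => //; exact: ltnW.
Qed.

Lemma birk_telescope alpha f q s :
  birk alpha f q (s + alpha) (+) birk alpha f q s = f (s + q%:R * alpha) (+) f s.
Proof.
elim: q => [|q IH]; first by rewrite !birk0 mul0r addr0 !addbb.
rewrite !birkS addbACA IH (_ : s + alpha + q%:R * alpha = s + q.+1%:R * alpha).
  by case: (f _); case: (f _); case: (f _).
by rewrite -natr1; ring.
Qed.

(** For an event [f] this is a length function on the circle: periodic, even and subadditive in
    [t]. *)
Definition shd f t := cm (fun s => f s (+) f (s - t)).

Lemma shd_periodz f t (n : int) : event f -> shd f (t + n%:~R) = shd f t.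
Proof.
move=> ef; apply: cm_eq => s _; congr (_ (+) _).
by rewrite opprD addrA -intrN event_periodz.
Qed.

Lemma shdN f t : event f -> shd f (- t) = shd f t.
Proof.
move=> ef; rewrite /shd -(@cm_shift _ (fun s => f s (+) f (s - t)) t).
  by apply: cm_eq => s _; rewrite opprK addrK addbC.
by apply: event_xor => //; exact: event_shift.
Qed.

Lemma shdD f t u : event f -> shd f (t + u) <= shd f t + shd f u.
Proof.
move=> ef; rewrite /shd.
have -> : cm (fun s => f s (+) f (s - u)) = cm (fun s => f (s - t) (+) f (s - (t + u))).
  rewrite -(@cm_shift _ (fun s => f s (+) f (s - u)) (- t)).
    by apply: cm_eq => s _; rewrite opprD addrA.
  by apply: event_xor => //; exact: event_shift.
by apply: cm_xor; [exact: ef.1|exact: (event_shift _ ef).1|exact: (event_shift _ ef).1].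
Qed.

Lemma shd_dist f t u : event f -> `|shd f t - shd f u| <= shd f (t - u).
Proof.
move=> ef; rewrite ler_norml.
have := shdD (t - u) u ef; have := shdD (u - t) t ef.
by rewrite !subrK -(shdN (u - t))// opprB => ? ?; apply/andP; split; lra.
Qed.

Lemma shd_mulrn f t (n : nat) : event f -> shd f (n%:R * t) <= n%:R * shd f t.
Proof.
move=> ef; elim: n => [|n IH].
  rewrite !mul0r /shd (cm_eq (g := fun=> false)) ?cm_cst// => s _.
  by rewrite subr0 addbb.
by rewrite -natr1 !mulrDl !mul1r (le_trans (shdD _ _ ef))// lerD2r.
Qed.

(** Subadditivity spreads continuity at 0 to every point. *)
Lemma measurable_shd f : event f -> measurable_fun setT (shd f).
Proof.
move=> ef; apply: continuous_measurable_fun => t; apply/cvgrPdist_lt => e e0.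
have [d d0 hd] := cm_shift_continuous ef e0.
apply/nbhs_ballP; exists d => //= u tu; apply: (le_lt_trans (shd_dist _ _ ef)).
by apply: hd; rewrite normrN.
Qed.

Lemma shd_birk alpha f q t : event f ->
  shd (birk alpha f q) t <= q%:R * shd f t.
Proof.
move=> ef; have e1 : event (fun s => f s (+) f (s - t)).
  by apply: event_xor => //; exact: event_shift.
apply: (le_trans _ (cm_birk alpha q e1)).
rewrite [leLHS](@cm_eq _ _ (birk alpha (fun s => f s (+) f (s - t)) q))// => s _.
by rewrite birk_xor birk_shift.
Qed.

(** A shift by [alpha] only drops one end term of the Birkhoff sum and adds another, so the bound
    does not depend on [q]. *)
Lemma shd_birk_step alpha f q : event f -> shd (birk alpha f q) alpha <= 2 * cm f.
Proof.
move=> ef; have e1 := event_birk alpha q ef; rewrite -shdN//.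
have e2 := event_shift (q%:R * alpha) ef.
have -> : 2 * cm f = cm (fun s => f (s + q%:R * alpha)) + cm f.
  by rewrite cm_shift//; ring.
apply: (le_trans _ (cm_or e2.1 ef.1)).
apply: cm_le; [|exact: (event_or e2 ef).1|].
  by apply: (event_xor _ _).1 => //; exact: event_shift.
by move=> s _; rewrite opprK addbC birk_telescope; case: (f _); case: (f _).
Qed.

(** The second difference is rewritten with two initial arcs of length [t], which gives a bound
    uniform in [x]. *)
Lemma shd_final_arc x t : 0 <= x < 1 -> 0 <= t < 1 -> shd (final_arc x) t <= 2 * t.
Proof.
move=> x01 t01; have ea := event_initial_arc t; have eax := event_shift x ea.
have -> : 2 * t = cm (initial_arc t) + cm (fun s => initial_arc t (s + x)).
  by rewrite cm_shift// cm_initial_arc; lra.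
apply: (le_trans _ (cm_or ea.1 eax.1)).
apply: cm_le; [|exact: (event_or ea eax).1|].
  by apply: (event_xor _ _).1; [|apply: event_shift]; exact: event_final_arc.
by move=> s _; rewrite -initial_arc_final_arc//; case: (initial_arc _ _); case: (initial_arc _ _).
Qed.

End shift_distance.

(** * Record denominators and the values of the shift distance at them *)

Section records.
Variable R : realType.
Implicit Types (f g h : R -> bool) (s t u x y alpha : R) (q : nat).

(** Any [q] consecutive points of an orbit of the rotation are pairwise at circle distance at least
    [1 / (2 q)]; letting [p] range over all integers encodes the distance to the nearest one. *)
Definition separated_orbit alpha q := forall (r : nat) (p : int),
  (0 < r < q)%N -> (2 * q%:R)^-1 <= `|r%:R * alpha - p%:~R|.

Lemma dist_int_gt0 x : (forall p : int, x - p%:~R != 0) ->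
  exists2 d, 0 < d & forall p : int, d <= `|x - p%:~R|.
Proof.
move=> x0; have /andP[f0 f1] := fpart_itv x.
have {}f0 : 0 < fpart x by rewrite lt_neqAle f0 eq_sym x0.
exists (Num.min (fpart x) (1 - fpart x)); first by rewrite lt_min f0 subr_gt0.
move=> p; rewrite ge_min ler_normr ler_normr.
have [pf|pf] := leP p (Num.floor x).
  have : (p%:~R : R) <= (Num.floor x)%:~R by rewrite ler_int.
  by rewrite /fpart => ?; apply/orP; left; apply/orP; left; lra.
have : ((Num.floor x + 1)%:~R : R) <= p%:~R by rewrite ler_int lezD1.
by rewrite intrD mulr1z /fpart => ?; apply/orP; right; apply/orP; right; lra.
Qed.

Lemma small_multiples_gt0 alpha (n : nat) : irrational alpha ->
  exists2 d, 0 < d & forall (r : nat) (p : int), (0 < r <= n)%N ->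
    d <= `|r%:R * alpha - p%:~R|.
Proof.
move=> irr; elim: n => [|n [d d0 dn]].
  by exists 1 => // r p; case: r.
have [d' d'0 d'n] := dist_int_gt0 (fun p => irrational_neq p irr (ltn0Sn n)).
exists (Num.min d d'); first by rewrite lt_min d0.
move=> r p /andP[r0]; rewrite leq_eqVlt => /orP[/eqP ->|rn].
  by rewrite ge_min d'n orbT.
by rewrite ge_min dn// r0.
Qed.

(* If [|q alpha - p| < |r alpha - p'|] for all [0 < r < q], then [q p' - r p] is a nonzero
   integer of absolute value at most [2 q |r alpha - p'|]. *)
Lemma record_separated alpha q (p : int) e : `|q%:R * alpha - p%:~R| < e ->
  (forall (r : nat) (p' : int), (0 < r < q)%N -> e <= `|r%:R * alpha - p'%:~R|) ->
  separated_orbit alpha q.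
Proof.
move=> qe re r p' /andP[r0 rq]; have {}re := re r p'; rewrite r0 rq in re.
have {}re := lt_le_trans qe (re isT).
have r0' : 0 < r%:R :> R by rewrite ltr0n.
have rq' : r%:R < q%:R :> R by rewrite ltr_nat.
have q0 : 0 < q%:R :> R by apply: lt_trans rq'.
set a := q%:R * alpha - p%:~R in qe re *.
set b := r%:R * alpha - p'%:~R in re *.
pose z : int := q%:Z * p' - r%:Z * p.
have zE : z%:~R = r%:R * a - q%:R * b :> R.
  by rewrite /z intrB !intrM /a /b; ring.
have z0 : z != 0.
  apply/eqP => z0; move: zE; rewrite z0 => /eqP.
  rewrite eq_sym subr_eq0 => /eqP /(congr1 (fun c => `|c|)).
  rewrite !normrM !normr_nat => ab.
  have : r%:R * `|a| < q%:R * `|b|.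
    apply: (@le_lt_trans _ _ (q%:R * `|a|)); last by rewrite ltr_pM2l.
    by rewrite ler_wpM2r// ltW.
  by rewrite ab ltxx.
have : 1 <= `|z%:~R : R|.
  by rewrite -intr_norm ler1z; lia.
rewrite zE => zab; rewrite -(ler_pM2l (x := 2 * q%:R)) ?mulr_gt0// divff ?gt_eqF ?mulr_gt0//.
rewrite (le_trans zab)// (le_trans (ler_normB _ _))// !normrM !normr_nat.
have : r%:R * `|a| <= q%:R * `|b|.
  apply: (@le_trans _ _ (q%:R * `|a|)); first by rewrite ler_wpM2r// ltW.
  by rewrite ler_wpM2l ?ltW.
lra.
Qed.

(** Take the least [q > 0] that approximates to within [Num.min d e], where [d] bounds from below
    what denominators up to [n] achieve. Then [d] forces [n < q], and minimality gives
    separation. *)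
Lemma record_denominator alpha (n : nat) e : irrational alpha -> 0 < e ->
  exists q, [/\ (n < q)%N, separated_orbit alpha q &
    exists p : int, `|q%:R * alpha - p%:~R| < e].
Proof.
move=> irr e0; have [d d0 dn] := small_multiples_gt0 n irr.
have c0 : 0 < Num.min d e by rewrite lt_min d0.
pose P q := (0 < q)%N && `[< exists p : int, `|q%:R * alpha - p%:~R| < Num.min d e >].
have : exists q, P q.
  have [q [p q0 qp]] := dirichlet alpha c0.
  by exists q; rewrite /P q0; apply/asboolP; exists p.
move=> exP; case: (ex_minnP exP) => q /andP[q0 /asboolP[p qp]] qmin; exists q; split.
- rewrite ltnNge; apply/negP => qn; have := dn q p; rewrite q0 qn => /(_ isT).
  by move: qp; rewrite lt_min => /andP[+ _] => /lt_le_trans /[apply]; rewrite ltxx.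
- apply: (record_separated qp) => r p' /andP[r0 rq]; rewrite leNgt; apply/negP => rp.
  have : P r by rewrite /P r0; apply/asboolP; exists p'.
  by move=> /qmin; rewrite leqNgt rq.
- by exists p; move: qp; rewrite lt_min => /andP[].
Qed.

Lemma final_arc_separated alpha q y s (j k : nat) : separated_orbit alpha q ->
  y <= (2 * q%:R)^-1 -> (j < q)%N -> (k < q)%N ->
  final_arc y (s + j%:R * alpha) -> final_arc y (s + k%:R * alpha) -> j = k.
Proof.
move=> sep yq; wlog jk : j k / (j < k)%N.
  move=> H; have [jk|kj|//] := ltngtP j k; first exact: H.
  by move=> ? ? ? ?; apply/esym; exact: H.
move=> jq kq; set a := s + j%:R * alpha; set b := s + k%:R * alpha => aj bk.
have /andP[a0 a1] := fpart_itv a; have /andP[b0 b1] := fpart_itv b.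
have := sep (k - j)%N (Num.floor b - Num.floor a).
have -> : (0 < k - j < q)%N by rewrite subn_gt0 jk (leq_ltn_trans (leq_subr _ _)).
have -> : (k - j)%:R * alpha - (Num.floor b - Num.floor a)%:~R = fpart b - fpart a.
  by rewrite natrB 1?ltnW// intrB /fpart /a /b; ring.
move=> /(_ isT) qab; have : `|fpart b - fpart a| < y.
  by move: aj bk; rewrite /final_arc ltr_norml => ? ?; apply/andP; split; lra.
by move=> /lt_le_trans /(_ yq) /lt_le_trans /(_ qab); rewrite ltxx.
Qed.

(** By separation the [K] translated arcs are disjoint, so the sum mod 2 is the indicator of their
    union. *)
Lemma cm_birk_final_arc alpha q y (K : nat) : separated_orbit alpha q ->
  0 <= y <= 1 -> y <= (2 * q%:R)^-1 -> (K <= q)%N ->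
  cm (birk alpha (final_arc y) K) = K%:R * y.
Proof.
move=> sep y01 yq; elim: K => [|K IH] Kq.
  by rewrite (cm_eq (g := fun=> false)) ?cm_cst ?mul0r// => s _; rewrite birk0.
have disj s : birk alpha (final_arc y) K s -> ~~ final_arc y (s + K%:R * alpha).
  move=> /birk_exists[j jK cj]; apply/negP => cK.
  have jq := ltn_trans jK Kq.
  by move: jK; rewrite (final_arc_separated sep yq jq Kq cj cK) ltnn.
rewrite -natr1 mulrDl mul1r -IH 1?ltnW// -[X in _ + X](cm_final_arc y01).
rewrite -(cm_shift (K%:R * alpha) (event_final_arc y)) -cm_disjoint//.
- apply: cm_eq => s _; rewrite birkS; have := disj s.
  by case: birk => //= /(_ isT) /negbTE ->.
- exact: (event_birk _ _ (event_final_arc y)).1.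
- exact: (event_shift _ (event_final_arc y)).1.
Qed.

Lemma cm_has (F : nat -> R -> bool) (c : R) (n : nat) :
  (forall j, event (F j)) -> (forall j, cm (F j) <= c) ->
  event (fun s => has (F^~ s) (iota 0 n)) /\
  cm (fun s => has (F^~ s) (iota 0 n)) <= n%:R * c.
Proof.
move=> eF Fc; elim: n => [|n [IH1 IH2]]; first by rewrite /= cm_cst mul0r; split.
have -> : (fun s => has (F^~ s) (iota 0 n.+1)) =
    (fun s => has (F^~ s) (iota 0 n) || F n s).
  by apply/funext => s; rewrite -addn1 iotaD has_cat /= orbF.
split; first exact: event_or.
by rewrite (le_trans (cm_or IH1.1 (eF n).1))// -natr1 mulrDl mul1r lerD.
Qed.

Section record_bounds.
Variables (alpha : R) (q : nat).
Hypotheses (q8 : (8 <= q)%N) (sep : separated_orbit alpha q).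

(** A quarter of the separation of the orbit; it gives [Psi] measure [q x = 1 / 8]. *)
Let x := (8 * q%:R)^-1 : R.
Let Psi := birk alpha (final_arc x) q.

Let xE : [/\ 0 < x, x <= 1 / 64, q%:R * x = 1 / 8 & x <= (2 * q%:R)^-1].
Proof.
have q8R : 8 <= q%:R :> R by rewrite ler_nat.
have x0 : 0 < x by rewrite invr_gt0; lra.
have qx : q%:R * x = 1 / 8 by rewrite /x; field; apply: lt0r_neq0; lra.
split=> //; first by nra.
by rewrite lef_pV2 ?posrE; lra.
Qed.
Let ePsi : event Psi. Proof. exact/event_birk/event_final_arc. Qed.

Lemma shd_birk_final_arc_step t : `|shd Psi (t + alpha) - shd Psi t| <= 2 * x.
Proof.
have [x0 x1 _ _] := xE.
rewrite (le_trans (shd_dist _ _ ePsi))// addrAC subrr add0r.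
rewrite (le_trans (shd_birk_step _ _ (event_final_arc x)))// cm_final_arc//; lra.
Qed.

(* [Psi] is almost invariant under the shift by [- (j alpha + r)] for small [j / q] and
   [q r]. *)
Lemma shd_birk_final_arc_small : 1 / 256 <= cm (fun t => shd Psi t <= 1 / 8).
Proof.
(* With [j < K] and [r <= y], the shifts by [j alpha] and by [r] each cost at most
   [q x / 2 = 1 / 16]. The good [t] have measure [K y >= (q / 8) (x / 4) = 1 / 256]. *)
have [x0 x1 qx xq] := xE; pose K := (q %/ 4)%N; pose y := x / 4.
have K4 : 4 * K%:R <= q%:R :> R by rewrite -natrM ler_nat /K; lia.
have K8 : q%:R <= 8 * K%:R :> R by rewrite -natrM ler_nat /K; lia.
have yq : y <= (2 * q%:R)^-1 by apply: le_trans xq; rewrite /y; lra.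
apply: (@le_trans _ _ (K%:R * y)).
  by rewrite /y; nra.
rewrite -(cm_birk_final_arc (y := y) sep)//; last 2 first.
- by rewrite /y; lra.
- by rewrite /K; lia.
apply: cm_le; first exact: (event_birk _ _ (event_final_arc y)).1.
  by apply: measurable_fun_ler => //; exact: measurable_shd.
move=> t _ /birk_exists[j jK]; set a := t + j%:R * alpha; rewrite /final_arc => ya.
have /andP[a0 a1] := fpart_itv a; pose r := 1 - fpart a.
have -> : t = - (j%:R * alpha + r) + (Num.floor a + 1)%:~R.
  by rewrite intrD mulr1z /r /fpart /a; ring.
have r1 : 0 <= r < 1 by rewrite /r; move: ya; rewrite /y; lra.
rewrite shd_periodz// shdN// (le_trans (shdD _ _ ePsi))//.
have h1 : shd Psi (j%:R * alpha) <= j%:R * (2 * x).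
  rewrite (le_trans (shd_mulrn _ _ ePsi))// ler_wpM2l//.
  by rewrite (le_trans (shd_birk_step _ _ (event_final_arc x)))// cm_final_arc//; lra.
have h2 : shd Psi r <= q%:R * (2 * r).
  rewrite (le_trans (shd_birk _ _ _ (event_final_arc x)))// ler_wpM2l//.
  by apply: shd_final_arc; lra.
have jK' : j%:R <= K%:R :> R by rewrite ler_nat ltnW.
have ry : r <= y by rewrite /r; move: ya; lra.
move: ry; rewrite /y; nra.
Qed.

(* Away from a union of [2 q] arcs of length [2 x], the supports of [Psi] and of its shift
   are disjoint. *)
Lemma shd_birk_final_arc_large : 1 / 2 <= cm (fun t => 1 / 4 <= shd Psi t).
Proof.
have [x0 x1 qx xq] := xE.
(* If [s + j alpha] and [s - t + k alpha] both lie in the final arc, then [t + (j - k) alpha] is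
   within [x] of 0 on the circle. The offset [q] turns [j - k] into a natural index below [2 q]; the
   exceptional [t] have measure at most [2 q * 2 x = 1 / 2]. *)
pose F (j : nat) t :=
  final_arc x (t + (j%:R - q%:R) * alpha) || initial_arc x (t + (j%:R - q%:R) * alpha).
have eF j : event (F j).
  by apply: event_or; apply: event_shift; [exact: event_final_arc|exact: event_initial_arc].
have Fx j : cm (F j) <= 2 * x.
  rewrite (le_trans (cm_or _ _))//.
  - exact: (event_shift _ (event_final_arc x)).1.
  - exact: (event_shift _ (event_initial_arc x)).1.
  - rewrite (cm_shift _ (event_final_arc x)) (cm_shift _ (event_initial_arc x)).
    by rewrite cm_final_arc ?cm_initial_arc; lra.
have [eH Hx] := cm_has (2 * q) eF Fx.
apply: (@le_trans _ _ (cm (fun t => ~~ has (F^~ t) (iota 0 (2 * q))))).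
  by rewrite cm_neg; [move: Hx; rewrite natrM; nra|exact: eH.1].
apply: cm_le; first exact: (event_neg eH).1.
  by apply: measurable_fun_ler => //; exact: measurable_shd.
move=> t _ nH.
have disj s : Psi s -> ~~ Psi (s - t).
  move=> /birk_exists[j jq aj]; apply/negP => /birk_exists[k kq bk].
  move/negP: nH; apply; apply/hasP; exists (j + (q - k))%N.
    by rewrite mem_iota; lia.
  set a := s + j%:R * alpha in aj; set b := s - t + k%:R * alpha in bk.
  rewrite /F natrD natrB 1?ltnW//.
  have /andP[a0 a1] := fpart_itv a; have /andP[b0 b1] := fpart_itv b.
  have -> : t + (j%:R + (q%:R - k%:R) - q%:R) * alpha =
      fpart a - fpart b + (Num.floor a - Num.floor b)%:~R.
    by rewrite intrB /fpart /a /b; ring.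
  move: aj bk; rewrite /final_arc /initial_arc fpart_addz => aj bk.
  have [ab|ab] := leP (fpart b) (fpart a).
    by rewrite [fpart (_ - _)]fpart_id; lra.
  rewrite -(fpart_addz _ 1) fpart_id mulr1z; lra.
have -> : shd Psi t = cm Psi + cm (fun s => Psi (s - t)).
  rewrite -cm_disjoint//; [|exact: ePsi.1|exact: (event_shift _ ePsi).1].
  apply: cm_eq => s _; have := disj s.
  by case: (Psi s) => //= /(_ isT) /negbTE ->.
rewrite cm_shift// /Psi (cm_birk_final_arc sep)//; last by apply/andP; split; lra.
by lra.
Qed.

End record_bounds.
End records.

(** * Asymptotic pairs: almost none exist, and coboundaries produce them *)

Section asymptotic_pairs.
Variable R : realType.
Implicit Types (f g h : R -> bool) (s t u x y : R).

Local Notation mu := (@lebesgue_measure R).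

Lemma cm_meet f g : measurable_fun setT f -> measurable_fun setT g ->
  1 < cm f + cm g -> exists2 s, f s & g s.
Proof.
move=> mf mg fg; apply: contrapT => nfg.
have mfg : measurable_fun setT (fun s => f s || g s) by exact: measurable_or.
have := cm_le1 mfg; rewrite cm_disjoint//; first by rewrite leNgt fg.
by move=> s fs; apply/negP => gs; apply: nfg; exists s.
Qed.

(** The factor 2 arises because both the event and its translate are replaced. *)
Lemma shd_close f g x : event f -> event g ->
  `|shd f x - shd g x| <= 2 * cm (fun s => f s (+) g s).
Proof.
move=> ef eg; have half f' g' : event f' -> event g' ->
    shd f' x <= shd g' x + 2 * cm (fun s => f' s (+) g' s).
  move=> ef' eg'; have efg := event_xor ef' eg'.
  have efx := event_xor ef' (event_shift (- x) ef').
  have egx := event_xor eg' (event_shift (- x) eg').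
  have efgx := event_shift (- x) efg.
  have -> : 2 * cm (fun s => f' s (+) g' s) =
      cm (fun s => f' s (+) g' s) + cm (fun s => f' (s - x) (+) g' (s - x)).
    by rewrite (cm_shift (- x) efg); ring.
  have e2 := event_or efg efgx.
  apply: (le_trans _ (lerD (lexx _) (cm_or efg.1 efgx.1))).
  apply: (le_trans _ (cm_or egx.1 e2.1)).
  apply: cm_le; [exact: efx.1|exact: (event_or egx e2).1|].
  by move=> s _; case: (f' s); case: (g' s); case: (f' _); case: (g' _).
have h1 := half f g ef eg; have h2 := half g f eg ef.
have e : cm (fun s => g s (+) f s) = cm (fun s => f s (+) g s).
  by apply: cm_eq => s _; rewrite addbC.
by rewrite ler_norml; rewrite e in h2; apply/andP; split; lra.
Qed.

Lemma shd_shift f u x : event f -> shd (fun s => f (s + u)) x = shd f x.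
Proof.
move=> ef; rewrite /shd -(@cm_shift _ (fun s => f s (+) f (s - x)) u).
  by apply: cm_eq => s _; rewrite addrAC.
by apply: event_xor => //; exact: event_shift.
Qed.

Section denominators.
Variables (alpha : R) (q : nat -> nat).
Hypothesis irr : irrational alpha.
Hypothesis q_gt : forall n, (n + 8 < q n)%N.
Hypothesis q_sep : forall n, separated_orbit alpha (q n).

Definition width n : R := (8 * (q n)%:R)^-1.

Definition spread n t := shd (birk alpha (final_arc (width n)) (q n)) t.

(** Convergence of the difference of spreads to 0, with tolerances [1 / (m + 1)] so that only
    countable set operations occur and measurability follows. *)
Definition asymptotic : set (R * R) := [set p | forall m : nat, exists k : nat,
  forall n, (k <= n)%N -> `|spread n p.1 - spread n p.2| <= m.+1%:R^-1].

Lemma width_itv n : 0 <= width n < 1.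
Proof.
have q8 : 8 <= (q n)%:R :> R by rewrite ler_nat; have := q_gt n; lia.
by rewrite /width invr_ge0 invf_lt1; lra.
Qed.

Lemma width_le n : 4 * width n <= n.+1%:R^-1.
Proof.
have qn : n.+1%:R <= (q n)%:R :> R by rewrite ler_nat; have := q_gt n; lia.
have n0 : 0 < n.+1%:R :> R by [].
have n0V : 0 < n.+1%:R^-1 :> R by rewrite invr_gt0.
have qV : (q n)%:R^-1 <= n.+1%:R^-1 :> R by rewrite lef_pV2 ?posrE//; lra.
rewrite /width invfM; move: n0V qV; move: (n.+1%:R^-1) ((q n)%:R^-1) => a b; lra.
Qed.

Lemma event_spread n : event (birk alpha (final_arc (width n)) (q n)).
Proof. exact/event_birk/event_final_arc. Qed.

Lemma measurable_asymptotic : measurable asymptotic.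
Proof.
have mspread n : measurable_fun setT (spread n).
  exact: measurable_shd (event_spread n).
have -> : asymptotic = \bigcap_m \bigcup_k \bigcap_(n in [set n | (k <= n)%N])
    [set p | `|spread n p.1 - spread n p.2| <= m.+1%:R^-1].
  apply/seteqP; split => p /= H.
    by move=> m _; have [k kn] := H m; exists k.
  by move=> m; have [k _ kn] := H m I; exists k.
apply: bigcap_measurableType => m _; apply: bigcup_measurable => k _.
apply: bigcap_measurableType => n _.
have mle : measurable_fun setT (fun p : R * R => `|spread n p.1 - spread n p.2| <= m.+1%:R^-1).
  apply: measurable_fun_ler => //; apply: measurableT_comp => //.
  by apply: measurable_funB; apply: measurableT_comp => //.
by have := mle measurableT [set true] I; rewrite setTI.
Qed.

Lemma asymptotic_shift (d : R) t t' :
  (forall n, `|spread n (t + d) - spread n t| <= 2 * width n) ->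
  asymptotic (t, t') -> asymptotic (t + d, t').
Proof.
(* This index gives half the tolerance [1 / (m + 1)]; the other half covers [2 * width n] once
   [n >= m]. *)
move=> td H m; have [k kn] := H (2 * m).+1.
exists (maxn k m) => n; rewrite geq_max => /andP[kn' mn].
have := kn n kn'; have := td n; have := width_le n; rewrite /=.
have : n.+1%:R^-1 <= m.+1%:R^-1 :> R by rewrite lef_pV2 ?posrE ?ler_nat.
have -> : (2 * m).+2%:R^-1 = m.+1%:R^-1 / 2 :> R.
  rewrite (_ : (2 * m).+2 = (m.+1 * 2)%N); last by lia.
  by rewrite natrM invfM.
move=> h1 h2 h3 h4.
rewrite (_ : _ - _ = (spread n (t + d) - spread n t) + (spread n t - spread n t')); last by ring.
rewrite (le_trans (ler_normD _ _))//.
by move: (m.+1%:R^-1) (n.+1%:R^-1) h1 h2 h3 h4 => a b; lra.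
Qed.

Lemma asymptotic_slice_event t' : event (fun t => `[< asymptotic (t, t') >]).
Proof.
split.
  apply: (measurable_fun_bool true); rewrite setTI.
  rewrite (_ : _ @^-1` _ = ysection asymptotic t').
    by apply: measurable_ysection; exact (measurable_asymptotic).
  apply/seteqP; split => t; rewrite /ysection /= inE; first by move/asboolP.
  by move=> ?; apply/asboolP.
move=> t; apply: asbool_equiv_eq; rewrite /asymptotic /=.
have e n : spread n (t + 1) = spread n t by exact: (shd_periodz t 1 (event_spread n)).
by split=> H m; have [k kn] := H m; exists k => n /kn; rewrite e.
Qed.

(* By ergodicity of the rotation a slice has measure 0 or 1. Measure 1 is impossible:
   [spread n] would be nearly constant on most of the circle for large [n], but it is at
   most 1/8 with probability at least 1/256, and at least 1/4 with probability at least 1/2. *)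
Lemma asymptotic_slice_null t' : cm (fun t => `[< asymptotic (t, t') >]) = 0.
Proof.
set h := fun t => `[< asymptotic (t, t') >]; have eh : event h := asymptotic_slice_event t'.
have q8 n : (8 <= q n)%N by have := q_gt n; lia.
have step n t : `|spread n (t + alpha) - spread n t| <= 2 * width n.
  exact: shd_birk_final_arc_step.
have ha t : h (t + alpha) = h t.
  apply: asbool_equiv_eq; split; last exact: asymptotic_shift.
  rewrite -[in X in _ -> X](addrK alpha t); apply: asymptotic_shift => n.
  by rewrite addrK distrC.
have [//|h1] := rotation_ergodic irr eh ha; exfalso.
have mspread n : measurable_fun setT (spread n).
  exact: measurable_shd (event_spread n).
(* The tolerance for [m = 16], just below 1/16: a window of this radius cannot contain both a value
   at most 1/8 and a value at least 1/4. *)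
pose b n t := `|spread n t - spread n t'| <= 17^-1.
have mb n : measurable_fun setT (b n).
  apply: measurable_fun_ler => //; apply: measurableT_comp => //.
  exact: measurable_funB.
pose S k := \bigcap_(n in [set n | (k <= n)%N]) [set t | b n t].
have mS k : measurable (S k).
  by apply: bigcap_measurableType => n _; exact: (measurable_event (mb n)).
pose F k := S k `&` `[0, 1[.
have mF k : measurable (F k) by apply: measurableI => //; exact: measurable_itv.
(* The [F k] increase to a set containing [h] on [0, 1[, so continuity from below applies. The
   defect 1/512 is below 1/256, which makes [b k] meet the set of small spread. *)
have [k Fk] : exists k, ((1 - 1 / 512)%:E < mu (F k))%E.
  apply: contrapT => nF.
  have Fle k : (mu (F k) <= (1 - 1 / 512)%:E)%E.
    by rewrite leNgt; apply/negP => ?; apply: nF; exists k.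
  have mUF : measurable (\bigcup_k F k) by exact: bigcup_measurable.
  have ndF : {homo F : n m / (n <= m)%N >-> (n <= m)%O}.
    move=> n m nm; rewrite subsetEset => t [St t01]; split => // i /= mi.
    by apply: St => /=; exact: leq_trans mi.
  have cF := nondecreasing_cvg_mu mF mUF ndF (mu := mu).
  have : (mu (\bigcup_k F k) <= (1 - 1 / 512)%:E)%E.
    rewrite -(cvg_lim _ cF)//; apply: lime_le; first by apply/cvg_ex; eexists; exact: cF.
    by apply: nearW => k; exact: Fle.
  have : (1%:E <= mu (\bigcup_k F k))%E.
    rewrite -h1 -cmE; last exact: eh.1.
    apply: le_measure; rewrite ?inE//; first by apply: measurable_event_itv; exact: eh.1.
    move=> t [/= /asboolP/(_ 16)[k kn] t01]; by exists k => //; split=> // n /= /kn.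
  by move=> /le_trans /[apply]; rewrite lee_fin; lra.
have bk : 1 - 1 / 512 < cm (b k).
  rewrite -lte_fin -cmE//; apply: (lt_le_trans Fk); apply: le_measure; rewrite ?inE//.
  - exact (mF k).
  - exact: measurable_event_itv.
  - by move=> t [St t01]; split => //; apply: St => /=.
have := shd_birk_final_arc_small (q8 k) (@q_sep k).
have := shd_birk_final_arc_large (q8 k) (@q_sep k).
rewrite -/(width k) -/(spread k) => large small.
have ms : measurable_fun setT (fun t => spread k t <= 1 / 8) by exact: measurable_fun_ler.
have ml : measurable_fun setT (fun t => 1 / 4 <= spread k t) by exact: measurable_fun_ler.
have [|s1 s1b s1s] := cm_meet (mb k) ms; first by lra.
have [|s2 s2b s2l] := cm_meet (mb k) ml; first by lra.
by move: s1b s2b; rewrite /b !ler_norml; lra.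
Qed.

Hypothesis q_return : forall n, exists p : int, `|(q n)%:R * alpha - p%:~R| < n.+1%:R^-1.

(* If the cocycle is the coboundary of [F] then its Birkhoff sums over the rigidity times
   [q n] tend to 0, i.e. the Birkhoff sums of [initial_arc t] and of the translate of
   [initial_arc t'] agree asymptotically, and the translation by [u] is invisible to [shd]. *)
Lemma coboundary_asymptotic t t' u F N : 0 <= t < 1 -> 0 <= t' < 1 ->
  event F -> event N -> cm N = 0 -> (forall s, N (s + alpha) = N s) ->
  (forall s, ~~ N s ->
    F (s + alpha) = F s (+) (initial_arc t s (+) initial_arc t' (s + u))) ->
  asymptotic (t, t').
Proof.
move=> t01 t'01 eF eN N0 Na Fa m.
pose c s := initial_arc t s (+) initial_arc t' (s + u).
have ec : event c by apply: event_xor; [|apply: event_shift]; exact: event_initial_arc.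
(* The coboundary equation telescopes along the whole orbit because [N] is invariant. *)
have Fc j s : ~~ N s -> birk alpha c j s = F s (+) F (s + j%:R * alpha).
  move=> Ns; elim: j => [|j IH]; first by rewrite birk0 mul0r addr0 addbb.
  rewrite birkS IH (_ : s + j.+1%:R * alpha = s + j%:R * alpha + alpha); last first.
    by rewrite -natr1; ring.
  have Nj : ~~ N (s + j%:R * alpha) by rewrite shift_mulrn.
  by rewrite [in RHS](Fa _ Nj) addbA.
have cc n : cm (birk alpha c (q n)) <= cm (fun s => F s (+) F (s + (q n)%:R * alpha)).
  have eFq : event (fun s => F s (+) F (s + (q n)%:R * alpha)).
    by apply: event_xor => //; exact: event_shift.
  rewrite -[leRHS]addr0 -N0; apply: (le_trans _ (cm_or eFq.1 eN.1)).
  apply: cm_le; [exact: (event_birk _ _ ec).1|exact: (event_or eFq eN).1|].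
  by move=> s _; have [Ns|Ns] := boolP (N s); rewrite ?orbT ?orbF// Fc.
have spreadE n a : 0 <= a < 1 -> spread n a = shd (birk alpha (initial_arc a) (q n)) (width n).
  move=> a01; have ea := event_birk alpha (q n) (event_initial_arc a).
  rewrite -(shdN (width n) ea); apply: cm_eq => s _.
  rewrite opprK -!birk_shift -!birk_xor; apply: eq_bigr => j _.
  by rewrite initial_arc_final_arc// width_itv.
have sc n : `|spread n t - spread n t'| <= 2 * cm (birk alpha c (q n)).
  rewrite !spreadE//; have et := event_birk alpha (q n) (event_initial_arc t).
  have et' := event_birk alpha (q n) (event_initial_arc t').
  rewrite -(shd_shift u (width n) et') (le_trans (shd_close _ et (event_shift u et')))//.
  by rewrite ler_wpM2l//; apply: cm_le; 
    [exact: (event_xor et (event_shift u et')).1|exact: (event_birk _ _ ec).1|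
     move=> s _; rewrite -birk_shift -birk_xor].
have e0 : 0 < m.+1%:R^-1 / 2 :> R by rewrite divr_gt0.
have [d d0 hd] := cm_shift_continuous eF e0.
exists (Num.trunc d^-1) => n dn; rewrite (le_trans (sc n))//.
have [p qp] := q_return n.
have nd : n.+1%:R^-1 < d.
  rewrite -[ltRHS]invrK ltf_pV2 ?posrE ?invr_gt0//.
  by rewrite (lt_le_trans (truncnS_gt _))// ler_nat.
have := hd _ (lt_trans qp nd); rewrite (@cm_eq _ _ (fun s => F s (+) F (s + (q n)%:R * alpha))).
  by have := cc n; move: (m.+1%:R^-1) => a; lra.
by move=> s _; rewrite addrA -intrN event_periodz.
Qed.

End denominators.
End asymptotic_pairs.

(** * From invariant sets of the extension to coboundaries *)

Section extension.
Variable R : realType.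
Implicit Types (c f g h : R -> bool) (s t u : R) (A : set (R * R)).

Local Notation mu := (@lebesgue_measure R).
Local Notation nu := (@haar_Z2 R).

Lemma haar_Z2E (B : set R) : nu B = (2^-1 * ((-1 \in B)%:R + (1 \in B)%:R))%:E.
Proof.
transitivity ((2^-1)%:E * (\d_(-1 : R)%R B + \d_(1 : R)%R B) : \bar R)%E.
  by congr (_ * _)%E; exact: measure_addE.
by rewrite !diracE -EFinD -EFinM.
Qed.

(** The fibre of [A] at level [k], extended periodically so that it is an event. *)
Definition slice A k s : bool := `[< A (fpart s, k) >].

Lemma event_slice A k : measurable A -> event (slice A k).
Proof.
move=> mA; split; last by move=> s; rewrite /slice (fpart_addz s 1).
apply: (measurable_fun_bool true); rewrite setTI.
have mf : measurable_fun setT (fun s : R => (fpart s, k)).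
  by apply: measurable_fun_pair => //; exact: measurable_fpart.
rewrite (_ : _ @^-1` _ = (fun s => (fpart s, k)) @^-1` A).
  by rewrite -[X in measurable X]setTI; exact: mf.
by apply/seteqP; split => s /=; [move/asboolP|move=> ?; apply/asboolP].
Qed.

Lemma product_haarE A : measurable A -> A `<=` @circle R `*` @Z2 R ->
  (mu \x nu)%E A = ((cm (slice A (-1)) + cm (slice A 1)) / 2)%:E.
Proof.
move=> mA AD; have e1 := event_slice 1 mA; have e2 := event_slice (-1) mA.
have inE1 s k : A (s, k) <-> slice A k s /\ 0 <= s < 1.
  split=> [As|[/asboolP + s01]]; last by rewrite fpart_id.
  have [/=] := AD _ As; rewrite /circle /= in_itv /= => s01 _.
  by split=> //; apply/asboolP; rewrite fpart_id.
pose I k := [set s | slice A k s] `&` `[0, 1[.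
have mI k : measurable (I k) by apply: measurable_event_itv; exact: (event_slice k mA).1.
have xI s : nu (xsection A s) = ((2^-1)%:E * ((\1_(I (-1)) s)%:E + (\1_(I 1) s)%:E))%E.
  rewrite haar_Z2E -EFinD -EFinM !indicE !mem_xsection.
  have sI k : ((s, k) \in A) = (s \in I k).
    apply/idP/idP; rewrite !inE.
      by move=> /inE1[? ?]; split => //=; rewrite in_itv.
    by move=> [/= ?]; rewrite in_itv /= => ?; apply/inE1.
  by rewrite !sI.
have mi k : measurable_fun setT (fun s => (\1_(I k) s)%:E : \bar R).
  by apply/measurable_EFinP; exact: measurable_indic.
have i0 k s : (0 <= (\1_(I k) s)%:E :> \bar R)%E by rewrite lee_fin.
rewrite /product_measure1 /=; under eq_integral do rewrite xI.
rewrite ge0_integralZl//; last 2 first.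
- by apply: emeasurable_funD; exact: mi.
- by move=> s _; rewrite -EFinD lee_fin addr_ge0.
rewrite ge0_integralD//; [|exact: mi|exact: mi].
rewrite !integral_indic//; [|exact (mI 1)|exact (mI (-1))].
rewrite !setIT.
have IE k : mu (I k) = (cm (slice A k))%:E by apply: cmE; exact: (event_slice k mA).1.
by rewrite [X in (_ * (X + _))%E]IE [X in (_ * (_ + X))%E]IE -EFinD -EFinM mulrC.
Qed.

Section sign_cocycle.
Variables (alpha : R) (phi : R -> R) (c : R -> bool).
Hypothesis ec : event c.
Hypothesis phiE : forall s, 0 <= s < 1 -> phi s = if c s then -1 else 1.

Let D := @circle R `*` @Z2 R.
Let T := Z2_extension alpha phi.

Lemma measurable_Z2 : measurable (@Z2 R).
Proof. by apply: measurableU; exact: measurable_set1. Qed.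

Let mD : measurable D.
Proof. by apply: measurableX; [exact: measurable_itv|exact: measurable_Z2]. Qed.

Let circle_addE s t : circle_add s t = fpart (s + t). Proof. by []. Qed.

Let cf s : c (fpart s) = c s.
Proof. by rewrite /fpart -intrN event_periodz. Qed.

Lemma slice_preimage A k s : Z2 k ->
  slice (D `&` T @^-1` A) k s = slice A (if c s then - k else k) (s + alpha).
Proof.
move=> k2; apply: asbool_equiv_eq; rewrite /T /Z2_extension /= circle_addE.
have -> : fpart (fpart s + alpha) = fpart (s + alpha).
  rewrite -[in RHS](fpart_addz _ (- Num.floor s)) intrN; congr fpart.
  by rewrite /fpart; ring.
rewrite phiE ?fpart_itv// cf.
have -> : k * (if c s then -1 else 1) = if c s then - k else k.
  by case: (c s); ring.
split=> [[]//|As]; split => //; split => //=.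
by rewrite /circle /= in_itv fpart_itv.
Qed.

Let Z2_1 : Z2 (1 : R). Proof. by right. Qed.
Let Z2_N1 : Z2 (-1 : R). Proof. by left. Qed.

(** The slices of the preimage are the rotated slices of [A], exchanged where [c] holds; neither the
    exchange nor the rotation alters the sum of their measures. *)
Lemma Z2_extension_measure_preserving : measure_preserving_on (mu \x nu)%E D T.
Proof.
have sT : set_fun D D T.
  move=> [s k] [/= s01 k2]; split; rewrite /T /=.
    by rewrite circle_addE /circle /= in_itv fpart_itv.
  rewrite phiE; last by move: s01; rewrite /circle /= in_itv.
  by case: (c s); case: k2 => ->; rewrite ?mulrN1 ?mulr1 ?opprK; [right|left|left|right].
have mT : measurable_fun D T.
  apply: (eq_measurable_fun (fun x : R * R =>
      (fpart (x.1 + alpha), x.2 * (if c x.1 then -1 else 1)))).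
    by move=> [s k] /[!inE] -[/= s01 _]; rewrite /T /Z2_extension /= phiE.
  apply: (measurable_funS measurableT) => //; apply: measurable_fun_pair.
    apply: measurableT_comp; first exact: measurable_fpart.
    by apply: measurable_funD => //; exact: measurable_fst.
  apply: measurable_funM; first exact: measurable_snd.
  by apply: measurable_fun_ifT => //; apply: measurableT_comp => //; exact: ec.1.
split=> // A mA AD.
rewrite product_haarE; [|exact: mT|exact: subIsetl].
rewrite product_haarE//; congr (_ / 2)%:E.
have e1 := event_slice 1 mA; have e2 := event_slice (-1) mA.
set p := fun s => slice A 1 (s + alpha); set m := fun s => slice A (-1) (s + alpha).
have ep : event p by exact: event_shift.
have em : event m by exact: event_shift.
have nc := event_neg ec.
have mif f g : measurable_fun setT f -> measurable_fun setT g ->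
    cm (fun s => if c s then f s else g s) = cm (fun s => f s && c s) + cm (fun s => g s && ~~ c s).
  move=> mf mg; rewrite (@cm_split _ (fun s => if c s then f s else g s) c); last 2 first.
  - by apply: measurable_fun_ifT => //; exact: ec.1.
  - exact: ec.1.
  by congr (_ + _); apply: cm_eq => s _; case: (c s); rewrite ?andbT ?andbF.
rewrite -(cm_shift alpha e1) -(cm_shift alpha e2) -/p -/m.
rewrite (@cm_eq _ (slice _ (-1)) (fun s => if c s then p s else m s)); last first.
  by move=> s _; rewrite slice_preimage// opprK; case: (c s).
rewrite (@cm_eq _ (slice _ 1) (fun s => if c s then m s else p s)); last first.
  by move=> s _; rewrite slice_preimage//; case: (c s).
rewrite (mif _ _ ep.1 em.1) (mif _ _ em.1 ep.1).
by rewrite (cm_split ep.1 ec.1) (cm_split em.1 ec.1); ring.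
Qed.

(* For an invariant set with slices [p] and [m], the events [p && m] and [p || m] are
   rotation invariant; if neither decides the measure of the set, [p] is a.e. the complement
   of [m] and the cocycle is the coboundary of [p]. *)
Lemma nonergodic_coboundary : irrational alpha -> ~ ergodic_cocycle alpha phi ->
  exists F N, [/\ event F, event N, cm N = 0, (forall s, N (s + alpha) = N s) &
    forall s, ~~ N s -> F (s + alpha) = F s (+) c s].
Proof.
move=> irr nerg; apply: contrapT => ncob; apply: nerg.
split; first exact: Z2_extension_measure_preserving.
move=> A mA AD TA.
have ep := event_slice 1 mA; have em := event_slice (-1) mA.
set p := slice A 1 in ep *; set m := slice A (-1) in em *.
have pE s : p s = if c s then m (s + alpha) else p (s + alpha).
  by rewrite /p -{1}TA slice_preimage//; case: (c s).
have mE s : m s = if c s then p (s + alpha) else m (s + alpha).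
  by rewrite /m -{1}TA slice_preimage// opprK; case: (c s).
have eI := event_and ep em; have eU := event_or ep em.
have Ia s : p (s + alpha) && m (s + alpha) = p s && m s.
  by rewrite (pE s) (mE s); case: (c s) => //; rewrite andbC.
have Ua s : p (s + alpha) || m (s + alpha) = p s || m s.
  by rewrite (pE s) (mE s); case: (c s) => //; rewrite orbC.
have [I0|I1] := rotation_ergodic irr eI Ia; last first.
  right; rewrite product_haarE; [|exact: measurableD|exact: subDsetl].
  have sD k s : Z2 k -> slice (D `\` A) k s = ~~ slice A k s.
    move=> k2; rewrite /slice -asbool_neg; apply: asbool_equiv_eq; split; first by case.
    by move=> nA; split => //; split => //=; rewrite /circle /= in_itv fpart_itv.
  rewrite (@cm_eq _ (slice _ (-1)) (fun s => ~~ m s)); last by move=> s _; exact: sD.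
  rewrite (@cm_eq _ (slice _ 1) (fun s => ~~ p s)); last by move=> s _; exact: sD.
  rewrite (cm_neg em.1) (cm_neg ep.1).
  have hp : cm (fun s => p s && m s) <= cm p.
    by apply: cm_le; [exact: eI.1|exact: ep.1|move=> s _ /andP[]].
  have hm : cm (fun s => p s && m s) <= cm m.
    by apply: cm_le; [exact: eI.1|exact: em.1|move=> s _ /andP[]].
  have := cm_le1 ep.1; have := cm_le1 em.1; rewrite I1 in hp hm => h1 h2.
  by congr (_%:E); lra.
have [U0|U1] := rotation_ergodic irr eU Ua.
  left; rewrite product_haarE//.
  have hp : cm p <= cm (fun s => p s || m s).
    by apply: cm_le; [exact: ep.1|exact: eU.1|move=> s _ ->].
  have hm : cm m <= cm (fun s => p s || m s).
    by apply: cm_le; [exact: em.1|exact: eU.1|move=> s _ ->; rewrite orbT].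
  have := cm_ge0 p; have := cm_ge0 m; rewrite U0 in hp hm => h1 h2.
  by congr (_%:E); rewrite -/p -/m; lra.
(* Here [p && m] is null and [p || m] conull, so [p] and [m] agree only on a null set. Off it,
   exchanging the slices means negating [p]. *)
exfalso; apply: ncob; exists p, (fun s => ~~ (p s (+) m s)).
have eN := event_neg (event_xor ep em); split => //.
- apply/eqP; rewrite eq_le cm_ge0 andbT.
  have eU' := event_neg eU.
  rewrite (_ : 0 = cm (fun s => p s && m s) + cm (fun s => ~~ (p s || m s))); last first.
    by rewrite I0 (cm_neg eU.1) U1; ring.
  apply: (le_trans _ (cm_or eI.1 eU'.1)).
  apply: cm_le; [exact: eN.1|exact: (event_or eI eU').1|].
  by move=> s _; case: (p s); case: (m s).
- by move=> s; rewrite (pE s) (mE s); case: (c s) => //; rewrite addbC.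
- move=> s; rewrite negbK (pE s) (mE s); case: (c s); last by rewrite addbF.
  by case: (p (s + alpha)); case: (m (s + alpha)).
Qed.

End sign_cocycle.

Lemma phi_pairE t t' u s : 0 <= s < 1 ->
  phi_pair t t' u s = if initial_arc t s (+) initial_arc t' (s + u) then -1 else 1.
Proof.
move=> s01; rewrite /phi_pair /phi_step.
have -> : circle_add s u = fpart (s + u) by [].
have /andP[f0 _] := fpart_itv (s + u).
rewrite !in_itv /= f0 (andP s01).1 /= /initial_arc (fpart_id s01).
by case: (s < t); case: (_ < t'); rewrite /= ?mulrNN ?mul1r ?mulr1.
Qed.

End extension.

Theorem theorem6p4 (R : realType) (alpha : R)
  (halpha : 0 < alpha < 1) (halpha_irr : irrational alpha) :
  (@lebesgue_measure R \x @lebesgue_measure R)%E.-negligible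
    ((@circle R `*` @circle R) `\` ergodic_pairs alpha).
Proof.
have /choice[q qP] n : exists q, [/\ (n + 8 < q)%N, separated_orbit alpha q &
    exists p : int, `|q%:R * alpha - p%:~R| < n.+1%:R^-1].
  by apply: record_denominator => //; rewrite invr_gt0.
have q_gt n : (n + 8 < q n)%N by have [] := qP n.
have q_sep n : separated_orbit alpha (q n) by have [] := qP n.
have q_return n : exists p : int, `|(q n)%:R * alpha - p%:~R| < n.+1%:R^-1.
  by have [] := qP n.
have mE := measurable_asymptotic alpha q.
have mC : measurable (@circle R `*` @circle R).
  by apply: measurableX; exact: measurable_itv.
(* The non-ergodic pairs are covered by the asymptotic ones, a measurable set. *)
exists (asymptotic alpha q `&` (@circle R `*` @circle R)); split.
- exact: measurableI.
(* The product measure integrates sections at a fixed first coordinate; symmetry of [asymptotic]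
   turns them into the slices already shown to be null. *)
- rewrite /product_measure1; apply: integral0_eq => t _ /=.
  have mh := (asymptotic_slice_event alpha q t).1.
  have h0 : lebesgue_measure ([set t' | `[< asymptotic alpha q (t', t) >]] `&` `[0, 1[) = 0%E.
    by rewrite cmE// asymptotic_slice_null.
  apply/eqP; rewrite eq_le measure_ge0 andbT -h0; apply: le_measure; rewrite ?inE.
  + by apply: measurable_xsection; exact: measurableI.
  + exact: measurable_event_itv.
  + move=> t'; rewrite /xsection /= inE => -[tt' [_ t'C]]; split => //=.
    apply/asboolP => m; have [k kn] := tt' m; exists k => n /kn /=.
    by rewrite distrC.
- move=> [t t'] [[/= tC t'C] nerg].
  split=> //; apply: contrapT => nas; apply: nerg; split => // u uC.
  move: tC t'C; rewrite /circle /= !in_itv /= => t01 t'01.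
  have ec : event (fun s => initial_arc t s (+) initial_arc t' (s + u)).
    by apply: event_xor; [|apply: event_shift]; exact: event_initial_arc.
  apply: contrapT => nerg; apply: nas.
  have [F [N [eF eN N0 Na Fa]]] :=
    nonergodic_coboundary ec (fun s => @phi_pairE R t t' u s) halpha_irr nerg.
  exact: (coboundary_asymptotic q_gt q_return t01 t'01 eF eN N0 Na Fa).
Qed.
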